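(* For every propositional formula $A$, $\mathbf{SPL}\vdash A$ (that is, $A\in\mathbf{SPL}$) if and only if $\mathbf{S}\vdash A^{\mathcal V}$.
   Context: Propositional formulas are built from propositional variables and $\bot$ using $\land,\lor,\to$; modal formulas additionally use $\Box$. Visser's Gödel translation $(\cdot)^{\mathcal V}$ from propositional to modal formulas: $p^{\mathcal V}=p\land\Box p$ for variables $p$; $\bot^{\mathcal V}=\bot$; $(A\land B)^{\mathcal V}=A^{\mathcal V}\land B^{\mathcal V}$; $(A\lor B)^{\mathcal V}=A^{\mathcal V}\lor B^{\mathcal V}$; $(A\to B)^{\mathcal V}=\Box(A^{\mathcal V}\to B^{\mathcal V})$. $\mathbf{GL}$ is the smallest normal modal logic containing all $\Box(\Box A\to A)\to\Box A$. $\mathbf S$ is the smallest set of modal formulas that contains all theorems of $\mathbf{GL}$ and all instances of $\Box A\to A$, and is closed under modus ponens (but not necessarily under necessitation). $\mathbf S\vdash A$ means $A\in\mathbf S$. $\mathbf{SPL}$ is the set of propositional formulas $A$ such that the sequent $\Rightarrow^{2}A$ (empty antecedent) is derivable in the calculus $\mathsf{G}_{\mathbf{SPL}}$, defined as follows. A sequent $\Gamma\Rightarrow^{\ell}\Delta$ of level $\ell\in\{1,2\}$ consists of two sets $\Gamma,\Delta$ of propositional formulas; commas denote union of sets and $A,\Gamma$ means $\{A\}\cup\Gamma$ (so contraction is built in). Rules are written ''premises / conclusion''; $\Gamma,\Delta,\Sigma$ are arbitrary sets of formulas and $A,B$ arbitrary formulas. For each $\ell\in\{1,2\}$: - axioms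 $p\Rightarrow^{\ell}p$ ($p$ a propositional variable) and $\bot\Rightarrow^{\ell}$ (empty succedent); - weakening: $\Gamma\Rightarrow^{\ell}\Delta$ / $A,\Gamma\Rightarrow^{\ell}\Delta$, and $\Gamma\Rightarrow^{\ell}\Delta$ / $\Gamma\Rightarrow^{\ell}\Delta,A$; - $A,B,\Gamma\Rightarrow^{\ell}\Delta$ / $A\land B,\Gamma\Rightarrow^{\ell}\Delta$; - $\Gamma\Rightarrow^{\ell}\Delta,A$ and $\Gamma\Rightarrow^{\ell}\Delta,B$ / $\Gamma\Rightarrow^{\ell}\Delta,A\land B$; - $A,\Gamma\Rightarrow^{\ell}\Delta$ and $B,\Gamma\Rightarrow^{\ell}\Delta$ / $A\lor B,\Gamma\Rightarrow^{\ell}\Delta$; - $\Gamma\Rightarrow^{\ell}\Delta,A,B$ / $\Gamma\Rightarrow^{\ell}\Delta,A\lor B$; together with - lift: $\Gamma\Rightarrow^{1}\Delta$ / $\Gamma\Rightarrow^{2}\Delta$; - at level 2 only: $\Gamma\Rightarrow^{2}\Delta,A$ and $B,\Gamma\Rightarrow^{2}\Delta$ / $A\to B,\Gamma\Rightarrow^{2}\Delta$; - at level 1 only, for every $k\ge 0$ and formulas $C_0,\dots,C_{k-1},D_0,\dots,D_{k-1}$, the rule with the $2^k$ premises $\Delta_i,\Sigma,A\to B,A\Rightarrow^{1}B,\Gamma_i$ ($0\le i<2^k$) and conclusion $\Sigma,\{C_j\to D_j:0\le j<k\}\Rightarrow^{1}A\to B$, where $\Delta_i=\{D_j:\text{the }j\text{-th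 binary digit of } i \text{ is }1\}$ and $\Gamma_i=\{C_j:\text{the }j\text{-th binary digit of } i\text{ is }0\}$, $0\le j<k$ (digit $j$ has weight $2^j$). There is no cut rule. *)

(* Defs.v *)
From mathcomp Require Import all_boot.
From mathcomp Require Import boolp classical_sets.

Set Implicit Arguments.
Unset Strict Implicit.
Unset Printing Implicit Defensive.

Local Open Scope classical_set_scope.

Inductive pform : Type :=
| PVar of nat
| PBot
| PAnd of pform & pform
| POr of pform & pform
| PImp of pform & pform.

Inductive mform : Type :=
| MVar of nat
| MBot
| MAnd of mform & mform
| MOr of mform & mform
| MImp of mform & mform
| Box of mform.

Fixpoint visser (A : pform) : mform :=
  match A with
  | PVar p => MAnd (MVar p) (Box (MVar p))
  | PBot => MBot
  | PAnd A B => MAnd (visser A) (visser B)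
  | POr A B => MOr (visser A) (visser B)
  | PImp A B => Box (MImp (visser A) (visser B))
  end.

Fixpoint msubst (s : nat -> mform) (A : mform) : mform :=
  match A with
  | MVar p => s p
  | MBot => MBot
  | MAnd A B => MAnd (msubst s A) (msubst s B)
  | MOr A B => MOr (msubst s A) (msubst s B)
  | MImp A B => MImp (msubst s A) (msubst s B)
  | Box A => Box (msubst s A)
  end.

(* Truth-table evaluation, with variables and boxed formulas as atoms. *)
Fixpoint bool_eval (v : nat -> bool) (b : mform -> bool) (A : mform) : bool :=
  match A with
  | MVar p => v p
  | MBot => false
  | MAnd A B => bool_eval v b A && bool_eval v b B
  | MOr A B => bool_eval v b A || bool_eval v b B
  | MImp A B => bool_eval v b A ==> bool_eval v b B
  | Box A => b A
  end.

Definition tautology (A : mform) : Prop := forall v b, bool_eval v b A.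

Definition mp_closed (L : set mform) : Prop :=
  forall A B, L (MImp A B) -> L A -> L B.

Record normal_logic (L : set mform) : Prop := NormalLogic {
  normal_taut : forall A, tautology A -> L A;
  normal_K : forall A B,
    L (MImp (Box (MImp A B)) (MImp (Box A) (Box B)));
  normal_mp : mp_closed L;
  normal_nec : forall A, L A -> L (Box A);
  normal_subst : forall s A, L A -> L (msubst s A)
}.

Definition logicGL : set mform :=
  smallest normal_logic [set MImp (Box (MImp (Box A) A)) (Box A) | A in setT].

Definition logicS : set mform :=
  smallest mp_closed (logicGL `|` [set MImp (Box A) A | A in setT]).

Inductive level : Type := L1 | L2.

Definition bit (j i : nat) : bool := odd (i %/ 2 ^ j).

Inductive GSPL : level -> set pform -> set pform -> Prop :=
| G_var l p : GSPL l [set PVar p] [set PVar p]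
| G_bot l : GSPL l [set PBot] set0
| G_wkl l A Gam Del : GSPL l Gam Del -> GSPL l (A |` Gam) Del
| G_wkr l A Gam Del : GSPL l Gam Del -> GSPL l Gam (Del `|` [set A])
| G_andl l A B Gam Del :
    GSPL l (A |` (B |` Gam)) Del -> GSPL l (PAnd A B |` Gam) Del
| G_andr l A B Gam Del :
    GSPL l Gam (Del `|` [set A]) -> GSPL l Gam (Del `|` [set B]) ->
    GSPL l Gam (Del `|` [set PAnd A B])
| G_orl l A B Gam Del :
    GSPL l (A |` Gam) Del -> GSPL l (B |` Gam) Del ->
    GSPL l (POr A B |` Gam) Del
| G_orr l A B Gam Del :
    GSPL l Gam (Del `|` [set A] `|` [set B]) ->
    GSPL l Gam (Del `|` [set POr A B])
| G_lift Gam Del : GSPL L1 Gam Del -> GSPL L2 Gam Del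
| G_impl A B Gam Del :
    GSPL L2 Gam (Del `|` [set A]) -> GSPL L2 (B |` Gam) Del ->
    GSPL L2 (PImp A B |` Gam) Del
| G_impr (k : nat) (C D : 'I_k -> pform) A B Sig :
    (forall i : 'I_(2 ^ k),
      GSPL L1
        ([set D j | j in [set j : 'I_k | bit j i]] `|` Sig
           `|` [set PImp A B] `|` [set A])
        (B |` [set C j | j in [set j : 'I_k | ~~ bit j i]])) ->
    GSPL L1 (Sig `|` [set PImp (C j) (D j) | j in setT]) [set PImp A B].

Definition SPL : set pform := [set A | GSPL L2 set0 [set A]].

(* Main.v *)
From HB Require Import structures.
From mathcomp Require Import all_boot.
From mathcomp Require Import boolp classical_sets cardinality.
Require Import Defs.

Set Implicit Arguments.
Unset Strict Implicit.
Unset Printing Implicit Defensive.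

Local Open Scope classical_set_scope.

(** Soundness reads a sequent as the implication from the conjunction of its
    translated antecedent to the disjunction of its translated succedent, which
    is a theorem of GL at level 1 and of S at level 2.  The only hard rule is
    right implication.  Write X for the translation of the implication A -> B
    before boxing, so that A -> B translates to [Box X].  The premises, taken
    together, say propositionally that the antecedent, together with the
    unboxed versions of its decomposed implications, implies
    [MImp (Box X) X].  Translated formulas are persistent
    ([visser_persistent]), so the antecedent implies the box of all these
    hypotheses, hence [Box (MImp (Box X) X)], hence [Box X] by Loeb's axiom
    ([sound_impr]).  Left implication at level 2 is the reflection axiom of S.

    Completeness is semantic and produces cut-free derivations.  Take the finite
    set F of subformulas of an underivable A.  Underivable sequents over F that
    have no underivable one-formula extension are saturated for the rules of
    conjunction and disjunction and, at level 2, for left implication.  The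
    level 1 ones are the worlds of a transitive frame: passing to a successor keeps the antecedent, strictly enlarges it, and
    decomposes each of its implications.  The right implication rule, read
    backwards, gives the successors that refute the implications of a succedent
    ([refute_implication]).  A level 2 saturated root containing A in its
    succedent decomposes its own implications too, so it may see copies of
    itself: below it hang infinitely many copies, the n-th one seeing all the
    previous ones.  In this tail model formulas in the antecedent of a world are
    true there and formulas in the succedent are false ([tail_truth]); thus the
    translation of A fails along the whole tail.  But every theorem of S is true
    at all sufficiently low points of a tail ([S_eventually]): if a formula fails
    somewhere on the tail, then its box fails everywhere below it. *)

(* Formulas are compared classically, so that they can be members of sequences. *)
HB.instance Definition _ := gen_eqMixin pform.
HB.instance Definition _ := gen_eqMixin mform.

(** * Derivations in GL and S *)

Record prop_theory (L : set mform) : Prop := PropTheory {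
  theory_taut : forall A, tautology A -> L A;
  theory_mp : mp_closed L
}.

Lemma theory_consequence L (ps : seq mform) Q : prop_theory L ->
  (forall P, P \in ps -> L P) ->
  (forall v b, all (bool_eval v b) ps -> bool_eval v b Q) -> L Q.
Proof.
move=> thL; elim: ps Q => [|P ps IH] Q Lps psQ.
  by apply: (theory_taut thL) => v b; apply: psQ.
apply: (theory_mp thL (A := P)); last by apply: Lps; rewrite mem_head.
apply: IH => [R Rps|v b psv /=]; first by apply: Lps; rewrite inE Rps orbT.
by apply/implyP => Pv; apply: psQ; rewrite /= Pv.
Qed.

Lemma theory_mp1 L P Q : prop_theory L -> L P ->
  (forall v b, bool_eval v b P -> bool_eval v b Q) -> L Q.
Proof.
move=> thL LP PQ; apply: (theory_mp thL _ LP).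
by apply: (theory_taut thL) => v b /=; apply/implyP/PQ.
Qed.

Lemma theory_mp2 L P1 P2 Q : prop_theory L -> L P1 -> L P2 ->
  (forall v b, bool_eval v b P1 -> bool_eval v b P2 -> bool_eval v b Q) -> L Q.
Proof.
move=> thL LP1 LP2 PQ; apply: (theory_mp thL _ LP2).
apply: (theory_mp1 thL LP1) => v b /= P1v; apply/implyP; exact: PQ.
Qed.

Lemma GL_normal : normal_logic logicGL.
Proof.
split.
- by move=> A tA L [nL _]; apply: (normal_taut nL).
- by move=> A B L [nL _]; apply: (normal_K nL).
- move=> A B AB LA L nL.
  exact: (normal_mp (proj1 nL) (AB L nL) (LA L nL)).
- move=> A LA L nL; exact: (normal_nec (proj1 nL) (LA L nL)).
- move=> s A LA L nL; exact: (normal_subst (proj1 nL) s (LA L nL)).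
Qed.

Lemma GL_lob A : logicGL (MImp (Box (MImp (Box A) A)) (Box A)).
Proof. by move=> L [_]; apply; exists A. Qed.

Lemma GL_theory : prop_theory logicGL.
Proof. split; [exact: (normal_taut GL_normal) | exact: (normal_mp GL_normal)]. Qed.

Lemma GL_sub_S : logicGL `<=` logicS.
Proof. by move=> A GLA L [_]; apply; left. Qed.

Lemma S_reflection A : logicS (MImp (Box A) A).
Proof. by move=> L [_]; apply; right; exists A. Qed.

Lemma S_theory : prop_theory logicS.
Proof.
split; first by move=> A tA; apply: GL_sub_S; exact: (theory_taut GL_theory).
move=> A B AB LA L mpL; exact: (proj1 mpL _ _ (AB L mpL) (LA L mpL)).
Qed.

Definition big_and : seq mform -> mform := foldr MAnd (MImp MBot MBot).
Definition big_or : seq mform -> mform := foldr MOr MBot.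

Lemma eval_big_and v b s : bool_eval v b (big_and s) = all (bool_eval v b) s.
Proof. by elim: s => //= A s ->. Qed.

Lemma eval_big_or v b s : bool_eval v b (big_or s) = has (bool_eval v b) s.
Proof. by elim: s => //= A s ->. Qed.

Lemma GL_box_mono A B : logicGL (MImp A B) -> logicGL (MImp (Box A) (Box B)).
Proof.
move=> AB; apply: (theory_mp GL_theory (normal_K GL_normal _ _)).
exact: (normal_nec GL_normal).
Qed.

Lemma GL_box_and_mono s X : logicGL (MImp (big_and s) X) ->
  logicGL (MImp (big_and (map Box s)) (Box X)).
Proof.
elim: s X => [|A s IH] X sX.
  apply: (theory_mp1 GL_theory (P := Box X)); last by move=> v b /= ->.
  apply: (normal_nec GL_normal).
  exact: (theory_mp1 GL_theory sX).
have /IH sAX : logicGL (MImp (big_and s) (MImp A X)).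
  apply: (theory_mp1 GL_theory sX) => v b /=.
  by case: (bool_eval v b A) => //=; rewrite implybT.
apply: (theory_mp2 GL_theory sAX (normal_K GL_normal A X)) => v b /=.
by case: (bool_eval _ _ _); case: (b (MImp A X)); case: (b A).
Qed.

(** From A follows [MImp (Box Q) Q] for Q the conjunction of A and [Box A], since
    [Box Q] gives [Box A]; boxing this and applying Loeb's axiom to Q yields the
    claim.  Both transitivity and the variable case of persistence come from
    it. *)
Lemma GL_box_strong A : logicGL (MImp (Box A) (Box (MAnd A (Box A)))).
Proof.
set Q := MAnd A (Box A).
have QA : logicGL (MImp (Box Q) (Box A)).
  apply: GL_box_mono; apply: (theory_taut GL_theory) => v b /=.
  by case: (bool_eval v b A); rewrite ?implybT.
have /GL_box_mono AQ : logicGL (MImp A (MImp (Box Q) Q)).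
  apply: (theory_mp1 GL_theory QA) => v b /=.
  by case: (bool_eval v b A).
apply: (theory_mp2 GL_theory AQ (GL_lob Q)) => v b /=.
by case: (b A); case: (b (MImp _ _)).
Qed.

Lemma GL_transitive A : logicGL (MImp (Box A) (Box (Box A))).
Proof.
have QA : logicGL (MImp (Box (MAnd A (Box A))) (Box (Box A))).
  apply: GL_box_mono; apply: (theory_taut GL_theory) => v b /=.
  by case: (bool_eval v b A); case: (b A).
apply: (theory_mp2 GL_theory (GL_box_strong A) QA) => v b /=.
by case: (b A); case: (b (MAnd _ _)).
Qed.

(** Variables are translated as conjunctions with their own boxes, and
    implications as boxes, exactly so that every translation is persistent. *)
Lemma visser_persistent A : logicGL (MImp (visser A) (Box (visser A))).
Proof.
elim: A => [p||A IA B IB|A IA B IB|A IA B IB] /=.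
- apply: (theory_mp1 GL_theory (GL_box_strong (MVar p))) => v b /=.
  by case: (v p).
- by apply: (theory_taut GL_theory) => v b.
- have AB : logicGL (MImp (big_and (map Box [:: visser A; visser B]))
      (Box (MAnd (visser A) (visser B)))).
    apply: GL_box_and_mono; apply: (theory_taut GL_theory) => v b /=.
    by case: (bool_eval _ _ _) => //=; case: (bool_eval _ _ _).
  apply: (theory_mp GL_theory _ IB).
  apply: (theory_mp2 GL_theory IA AB) => v b /=.
  case: (bool_eval v b (visser A)) => //= [->|_]; last by rewrite implybT.
  by case: (bool_eval v b (visser B)) => //=; case: (b (visser B)).
- have AAB : logicGL (MImp (Box (visser A)) (Box (MOr (visser A) (visser B)))).
    apply: GL_box_mono; apply: (theory_taut GL_theory) => v b /=.
    by case: (bool_eval _ _ _).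
  have BAB : logicGL (MImp (Box (visser B)) (Box (MOr (visser A) (visser B)))).
    apply: GL_box_mono; apply: (theory_taut GL_theory) => v b /=.
    by case: (bool_eval v b (visser B)); rewrite ?orbT.
  have {}AAB : logicGL (MImp (visser A) (Box (MOr (visser A) (visser B)))).
    apply: (theory_mp2 GL_theory IA AAB) => v b /=.
    by case: (bool_eval _ _ _); case: (b (visser A)).
  have {}BAB : logicGL (MImp (visser B) (Box (MOr (visser A) (visser B)))).
    apply: (theory_mp2 GL_theory IB BAB) => v b /=.
    by case: (bool_eval _ _ _); case: (b (visser B)).
  apply: (theory_mp2 GL_theory AAB BAB) => v b /=.
  by case: (bool_eval v b (visser A)) => /=.
- exact: GL_transitive.
Qed.

(** * Soundness of the calculus *)

Definition level_logic l := if l is L1 then logicGL else logicS.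

Lemma level_theory l : prop_theory (level_logic l).
Proof. by case: l; [exact: GL_theory | exact: S_theory]. Qed.

(** Antecedents and succedents of derivable sequents are sets; a sequent is
    interpreted through arbitrary sequences that cover these sets, which makes
    contraction and the merging of contexts invisible. *)
Definition visser_seq (gs ds : seq pform) : mform :=
  MImp (big_and (map visser gs)) (big_or (map visser ds)).

Lemma eval_visser_seq v b gs ds :
  reflect ((forall A, A \in gs -> bool_eval v b (visser A)) ->
           exists2 A, A \in ds & bool_eval v b (visser A))
          (bool_eval v b (visser_seq gs ds)).
Proof.
rewrite /= eval_big_and eval_big_or all_map has_map.
apply: (iffP implyP) => H.
  by move=> gsv; apply/hasP/H/allP.
by move=> /allP gsv; apply/hasP/H.
Qed.

(** The premises of right implication are numbered by all choices of one side
    for each decomposed implication. *)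
Lemma bits_surj k (f : nat -> bool) :
  exists2 i, i < 2 ^ k & forall j, j < k -> bit j i = f j.
Proof.
elim: k f => [|k IH] f; first by exists 0.
have [i ik fi] := IH (fun j => f j.+1).
exists (f 0 + i.*2).
  by rewrite expnS mul2n -ltn_half_double half_bit_double.
case=> [|j] jk; first by rewrite /bit expn0 divn1 oddD odd_double oddb addbF.
by rewrite /bit expnS divnMA divn2 half_bit_double; apply: fi.
Qed.

(** In a valuation where all the unboxed decomposed implications hold, let the
    digits of i record which of the consequents D hold.  Then the D in the
    antecedent of premise i are true and, by contraposition, the C in its
    succedent are false, so premise i forces B as soon as A holds.  The persistence of the
    antecedent and Loeb's axiom turn this propositional fact into the
    conclusion. *)
Lemma sound_impr k (C D : 'I_k -> pform) A B (gs ds : seq pform) :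
  (forall i : 'I_(2 ^ k), logicGL (visser_seq
     ([seq D j | j : 'I_k <- enum 'I_k & bit j i] ++ PImp A B :: A :: gs)
     (B :: [seq C j | j : 'I_k <- enum 'I_k & ~~ bit j i]))) ->
  (forall j, PImp (C j) (D j) \in gs) -> PImp A B \in ds ->
  logicGL (visser_seq gs ds).
Proof.
move=> prem CDgs ABds.
pose X := MImp (visser A) (visser B).
pose steps := [seq MImp (visser (C j)) (visser (D j)) | j <- enum 'I_k].
have local : logicGL (MImp (big_and (map visser gs ++ steps)) (MImp (Box X) X)).
  pose F (i : 'I_(2 ^ k)) := visser_seq
     ([seq D j | j : 'I_k <- enum 'I_k & bit j i] ++ PImp A B :: A :: gs)
     (B :: [seq C j | j : 'I_k <- enum 'I_k & ~~ bit j i]).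
  apply: (theory_consequence (ps := map F (enum 'I_(2 ^ k))) GL_theory).
    by move=> P /mapP[i _ ->]; apply: prem.
  move=> v b /allP Fv; rewrite /= eval_big_and all_cat all_map.
  apply/implyP => /andP[/allP gsv /allP stv].
  apply/implyP => /= bX; apply/implyP => Av.
  (* The digits are a function on nat, so D is extended by false beyond k. *)
  have [n nk bn] := bits_surj k
    (fun j => if insub j is Some j' then bool_eval v b (visser (D j')) else false).
  have {}bn (j : 'I_k) : bit j n = bool_eval v b (visser (D j)).
    by rewrite bn ?ltn_ord // insubT ?ltn_ord // => ?; congr (bool_eval _ _ (visser (D _))); apply: val_inj.
  have /eval_visser_seq : bool_eval v b (F (Ordinal nk)).
    by apply: Fv; apply: map_f; rewrite mem_enum.
  case=> [E|E].
    rewrite mem_cat => /orP[/mapP[j]|].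
      by rewrite mem_filter => /andP[jn _] ->; rewrite -bn.
    rewrite !inE => /or3P[/eqP->//|/eqP->//|]; exact: gsv.
  rewrite inE => /orP[/eqP->//|/mapP[j]].
  rewrite mem_filter bn /= => /andP[/negbTE Dj _] -> Cj.
  have /stv /= : MImp (visser (C j)) (visser (D j)) \in steps.
    by apply: (map_f (fun j => _)); rewrite mem_enum.
  by rewrite Cj Dj.
have boxed := GL_box_and_mono local.
have persistent : logicGL (MImp (big_and (map visser gs))
    (big_and (map Box (map visser gs ++ steps)))).
  apply: (theory_consequence GL_theory
    (ps := [seq MImp (visser G) (Box (visser G)) | G <- gs])).
    by move=> P /mapP[G _ ->]; apply: visser_persistent.
  move=> v b /allP pv; rewrite /= !eval_big_and all_map.
  apply/implyP => /allP gsv.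
  rewrite map_cat all_cat -!map_comp !all_map; apply/andP; split; apply/allP.
    move=> G Ggs /=; suff /implyP : bool_eval v b (MImp (visser G) (Box (visser G))).
      by apply; apply: gsv.
    by apply: pv; apply/mapP; exists G.
  by move=> j _ /=; apply: (gsv _ (CDgs j)).
have bX : logicGL (MImp (big_and (map visser gs)) (Box X)).
  apply: (theory_mp GL_theory _ (GL_lob X)).
  apply: (theory_mp2 GL_theory persistent boxed) => v b /=.
  move=> /implyP GP /implyP PX; apply/implyP => /implyP lob.
  by apply/implyP => /GP/PX/lob.
apply: (theory_mp1 GL_theory bX) => v b gsX.
apply/eval_visser_seq => gsv; exists (PImp A B) => //.
by move: gsX; rewrite /= eval_big_and all_map => /implyP; apply; apply/allP.
Qed.

(** The covering sequences are quantified inside the induction: a premise is used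
    with its active formulas consed onto the sequences covering the
    conclusion. *)
Lemma GSPL_sound l Gam Del : GSPL l Gam Del ->
  forall gs ds : seq pform, Gam `<=` [set` gs] -> Del `<=` [set` ds] ->
  level_logic l (visser_seq gs ds).
Proof.
elim=> {l Gam Del}.
- move=> l p gs ds Ggs Dds.
  apply: (theory_taut (level_theory l)) => v b; apply/eval_visser_seq => gsv.
  by exists (PVar p); [apply: Dds | apply/gsv/Ggs].
- move=> l gs ds Ggs _.
  apply: (theory_taut (level_theory l)) => v b; apply/eval_visser_seq => gsv.
  by have /gsv := Ggs _ erefl.
- move=> l A Gam Del _ IH gs ds Ggs; apply: IH => B GB; apply: Ggs; by right.
- move=> l A Gam Del _ IH gs ds Ggs Dds; apply: IH => // B DB; apply: Dds; by left.
- move=> l A B Gam Del _ IH gs ds Ggs Dds.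
  have ABgs : PAnd A B \in gs by apply: Ggs; left.
  have H : level_logic l (visser_seq (A :: B :: gs) ds).
    apply: IH => // E /= [->|[->|GE]]; rewrite !inE ?eqxx ?orbT //.
    by rewrite Ggs ?orbT //; right.
  apply: (theory_mp1 (level_theory l) H) => v b /eval_visser_seq {}H.
  apply/eval_visser_seq => gsv; apply: H => E.
  have /= /andP[Av Bv] := gsv _ ABgs.
  by rewrite !inE => /or3P[/eqP->|/eqP->|/gsv].
- move=> l A B Gam Del _ IA _ IB gs ds Ggs Dds.
  have ABds : PAnd A B \in ds by apply: Dds; right.
  have HA : level_logic l (visser_seq gs (A :: ds)).
    apply: IA => // E /= [DE|->]; rewrite inE ?eqxx //.
    by rewrite Dds ?orbT //; left.
  have HB : level_logic l (visser_seq gs (B :: ds)).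
    apply: IB => // E /= [DE|->]; rewrite inE ?eqxx //.
    by rewrite Dds ?orbT //; left.
  apply: (theory_mp2 (level_theory l) HA HB) => v b.
  move=> /eval_visser_seq {}HA /eval_visser_seq {}HB.
  apply/eval_visser_seq => gsv.
  have [E] := HA gsv; rewrite inE => /orP[/eqP-> Av|Eds Ev]; last by exists E.
  have [E'] := HB gsv; rewrite inE => /orP[/eqP-> Bv|Eds Ev]; last by exists E'.
  by exists (PAnd A B) => //=; rewrite Av Bv.
- move=> l A B Gam Del _ IA _ IB gs ds Ggs Dds.
  have ABgs : POr A B \in gs by apply: Ggs; left.
  have HA : level_logic l (visser_seq (A :: gs) ds).
    apply: IA => // E /= [->|GE]; rewrite inE ?eqxx //.
    by rewrite Ggs ?orbT //; right.
  have HB : level_logic l (visser_seq (B :: gs) ds).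
    apply: IB => // E /= [->|GE]; rewrite inE ?eqxx //.
    by rewrite Ggs ?orbT //; right.
  apply: (theory_mp2 (level_theory l) HA HB) => v b.
  move=> /eval_visser_seq {}HA /eval_visser_seq {}HB.
  apply/eval_visser_seq => gsv.
  have /= /orP[Av|Bv] := gsv _ ABgs.
    by apply: HA => E; rewrite inE => /orP[/eqP->|/gsv].
  by apply: HB => E; rewrite inE => /orP[/eqP->|/gsv].
- move=> l A B Gam Del _ IH gs ds Ggs Dds.
  have ABds : POr A B \in ds by apply: Dds; right.
  have H : level_logic l (visser_seq gs (A :: B :: ds)).
    apply: IH => // E /= [[DE|->]|->]; rewrite !inE ?eqxx ?orbT //.
    by rewrite Dds ?orbT //; left.
  apply: (theory_mp1 (level_theory l) H) => v b /eval_visser_seq {}H.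
  apply/eval_visser_seq => gsv; have [E] := H gsv.
  rewrite !inE => /or3P[/eqP->|/eqP->|Eds] Ev; last by exists E.
    by exists (POr A B) => //=; rewrite Ev.
  by exists (POr A B) => //=; rewrite Ev orbT.
- by move=> Gam Del _ IH gs ds Ggs Dds; apply: GL_sub_S; apply: IH.
- move=> A B Gam Del _ IA _ IB gs ds Ggs Dds.
  have ABgs : PImp A B \in gs by apply: Ggs; left.
  have HA : logicS (visser_seq gs (A :: ds)).
    apply: IA => [E GE|E /= [DE|->]]; rewrite ?inE ?eqxx //.
      by apply: Ggs; right.
    by rewrite Dds ?orbT.
  have HB : logicS (visser_seq (B :: gs) ds).
    apply: IB => // E /= [->|GE]; rewrite inE ?eqxx //.
    by rewrite Ggs ?orbT //; right.
  apply: (theory_mp S_theory _ (S_reflection (MImp (visser A) (visser B)))).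
  apply: (theory_mp2 S_theory HA HB) => v b.
  move=> /eval_visser_seq {}HA /eval_visser_seq {}HB.
  apply/implyP => /= /implyP refl; apply/eval_visser_seq => gsv.
  have [E] := HA gsv; rewrite inE => /orP[/eqP-> Av|Eds Ev]; last by exists E.
  have /implyP /(_ Av) Bv := refl (gsv _ ABgs).
  by apply: HB => G; rewrite inE => /orP[/eqP->|/gsv].
- move=> k C D A B Sig _ IH gs ds Ggs Dds.
  apply: (@sound_impr k C D A B) => [i|j|]; last exact: Dds.
    apply: (IH i) => E /=.
      rewrite mem_cat !inE => -[[[[j ji <-]|SE]|->]|->]; rewrite ?eqxx ?orbT //.
        by rewrite map_f // mem_filter ji mem_enum.
      by rewrite Ggs ?orbT //; left.
    case=> [->|[j ji <-]]; rewrite inE ?eqxx //.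
    by rewrite map_f ?orbT // mem_filter ji mem_enum.
  by apply: Ggs; right; exists j.
Qed.

(** * Kripke semantics *)

Section Kripke.
Variables (W : Type) (R : W -> W -> Prop).

Fixpoint sat (V : nat -> W -> Prop) (w : W) (A : mform) : Prop :=
  match A with
  | MVar p => V p w
  | MBot => False
  | MAnd A B => sat V w A /\ sat V w B
  | MOr A B => sat V w A \/ sat V w B
  | MImp A B => sat V w A -> sat V w B
  | Box A => forall w', R w w' -> sat V w' A
  end.

(** The formulas true at a world are those evaluated to true by the valuation
    that reads variables and boxed formulas off that world. *)
Lemma sat_tautology V w A : tautology A -> sat V w A.
Proof.
move=> tA; pose v p := `[< V p w >].
pose b B := `[< forall w', R w w' -> sat V w' B >].
suff E : `[< sat V w A >] = bool_eval v b A by apply/asboolP; rewrite E.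
clear tA; elim: A => [p||A IA B IB|A IA B IB|A IA B IB|A _] //=.
- exact: asboolF.
- by rewrite asbool_and IA IB.
- by rewrite asbool_or IA IB.
- by rewrite asbool_imply IA IB.
Qed.

Lemma sat_subst V w s A :
  sat V w (msubst s A) <-> sat (fun p w' => sat V w' (s p)) w A.
Proof.
elim: A w => //= [A IA B IB|A IA B IB|A IA B IB|A IA] w; rewrite ?IA ?IB //.
by split=> H w' /H /IA.
Qed.

(** A rank that decreases along R bounds the length of ascending paths from each
    world; this gives Loeb's axiom by induction on the rank of the successor. *)
Lemma GL_valid (rank : W -> nat) V w A :
  (forall x y z, R x y -> R y z -> R x z) ->
  (forall x y, R x y -> rank y < rank x) ->
  logicGL A -> sat V w A.
Proof.
move=> Rtrans Rrank GLA.
suff : [set B | forall V w, sat V w B] A by apply.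
apply: GLA => {V w A}; split; first split.
- by move=> A tA V w; apply: sat_tautology.
- by move=> A B V w /= AB HA w' Rw; apply: AB (HA _ Rw).
- by move=> A B /= AB HA V w; apply: AB (HA _ _).
- by move=> A /= HA V w w' _.
- by move=> s A /= HA V w; apply/sat_subst.
move=> _ [A _ <-] V w /= lob w' Rw.
have [n] := ubnP (rank w'); elim: n w' Rw => // n IH w' Rw rk.
apply: lob => // w'' Rw'; apply: IH; first exact: Rtrans Rw'.
by have := Rrank _ _ Rw'; move: rk; rewrite ltnS => /[swap]; apply: leq_trans.
Qed.

(** Being true at all but finitely many points of a tail is preserved by modus
    ponens, though not by necessitation.  An instance of reflection holds
    eventually because a failure of C at one point of the tail makes [Box C] fail
    at all the later ones. *)
Lemma S_eventually (rank : W -> nat) (tail : nat -> W) V A :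
  (forall x y z, R x y -> R y z -> R x z) ->
  (forall x y, R x y -> rank y < rank x) ->
  (forall m n, m < n -> R (tail n) (tail m)) ->
  logicS A -> exists N, forall n, N <= n -> sat V (tail n) A.
Proof.
move=> Rtrans Rrank Rtail SA.
apply: (SA [set B | exists N, forall n, N <= n -> sat V (tail n) B]); split.
  move=> B C /= [N BC] [M HB]; exists (maxn N M) => n.
  by rewrite geq_max => /andP[/BC] + /HB.
move=> B [GLB|[C _ <-]] /=; first by exists 0 => n _; exact: (GL_valid (rank := rank)).
have [allC|/existsNP[m nC]] := pselect (forall n, sat V (tail n) C).
  by exists 0.
by exists m.+1 => n mn bC; case: nC; apply/bC/Rtail.
Qed.

End Kripke.

(** * Cut-free countermodels *)

(** Finiteness is essential: the weakening rules add a single formula, so derivable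
    sequents are finite. *)
Lemma GSPL_weaken l Gam Del Gam' Del' : GSPL l Gam Del ->
  Gam `<=` Gam' -> Del `<=` Del' -> finite_set Gam' -> finite_set Del' ->
  GSPL l Gam' Del'.
Proof.
move=> prov GG DD /finite_seqP[gs eg] /finite_seqP[ds ed].
rewrite {}eg {}ed in GG DD *.
have set_cons B (s : seq pform) : [set` B :: s] = B |` [set` s].
  apply/seteqP; split=> C /=; rewrite inE; first by case/orP => [/eqP|]; auto.
  by case=> [->|->]; rewrite ?eqxx ?orbT.
have addl (s : seq pform) : GSPL l ([set` s] `|` Gam) Del.
  elim: s => [|A s IH]; first by rewrite set_nil set0U.
  by rewrite set_cons -setUA; apply: G_wkl.
have addr (s : seq pform) G : GSPL l G Del -> GSPL l G (Del `|` [set` s]).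
  elim: s => [|A s IH] pG; first by rewrite set_nil setU0.
  by rewrite set_cons (setUC [set A]) setUA; apply: G_wkr; apply: IH.
have := addr ds _ (addl gs).
by rewrite setUidl // setUidr.
Qed.

Lemma GSPL_id A : GSPL L1 [set A] [set A].
Proof.
elim: A => [p||A IA B IB|A IA B IB|A IA B IB].
- exact: G_var.
- by apply: (GSPL_weaken (G_bot L1)).
- rewrite -[X in GSPL _ X _](setU0 [set _]); apply: G_andl.
  rewrite -[X in GSPL _ _ X](set0U [set _]).
  by apply: G_andr; rewrite set0U;
    [apply: (GSPL_weaken IA) | apply: (GSPL_weaken IB)];
    rewrite ?setU0 ?finite_setU //; move=> ? /=; auto.
- rewrite -[X in GSPL _ _ X](set0U [set _]); apply: G_orr; rewrite set0U.
  rewrite -[X in GSPL _ X _](setU0 [set _]).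
  by apply: G_orl;
    [apply: (GSPL_weaken IA) | apply: (GSPL_weaken IB)];
    rewrite ?setU0 ?finite_setU //; move=> ? /=; auto.
- rewrite -[X in GSPL _ X _](_ : set0 `|` [set PImp A B | j in [set: 'I_1]] = _);
    last first.
    rewrite set0U; apply/seteqP; split=> [_ [j _ <-]|_ ->] //.
    by exists ord0.
  (* One decomposed implication, namely A -> B itself: the two premises then
     have A, respectively B, on both sides. *)
  apply: (G_impr (C := fun=> A) (D := fun=> B)) => i.
  have finI (T : Type) (f : 'I_1 -> T) X : finite_set (f @` X).
    by apply: finite_image; apply: finite_finset.
  case bi: (bit (ord0 : 'I_1) i).
    apply: (GSPL_weaken IB); rewrite ?finite_setU // => _ ->.
    by do 3 left; exists ord0.
  apply: (GSPL_weaken IA); rewrite ?finite_setU // => _ ->.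
  by right; exists ord0; rewrite /= ?bi.
Qed.

Fixpoint subformulas (A : pform) : seq pform :=
  A :: match A with
       | PAnd B C | POr B C | PImp B C => subformulas B ++ subformulas C
       | _ => [::]
       end.

Lemma subformulas_refl A : A \in subformulas A.
Proof. by case: A => *; rewrite /= mem_head. Qed.

Definition subformula_closed (F : seq pform) := forall B C,
  [/\ PAnd B C \in F -> B \in F /\ C \in F,
      POr B C \in F -> B \in F /\ C \in F &
      PImp B C \in F -> B \in F /\ C \in F].

Lemma subformulas_closed A : subformula_closed (subformulas A).
Proof.
have closedU (B C X : pform) : subformula_closed (subformulas B) ->
    subformula_closed (subformulas C) ->
    (forall D E, [\/ X = PAnd D E, X = POr D E | X = PImp D E] -> B = D /\ C = E) ->
    subformula_closed (X :: subformulas B ++ subformulas C).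
  move=> IB IC XBC D E; have [aB oB iB] := IB D E; have [aC oC iC] := IC D E.
  have self : B = D /\ C = E ->
      D \in X :: subformulas B ++ subformulas C /\
      E \in X :: subformulas B ++ subformulas C.
    by case=> <- <-; rewrite !inE !mem_cat !subformulas_refl !orbT.
  have lift (P Q : bool) : (P -> D \in subformulas B /\ E \in subformulas B) ->
      (Q -> D \in subformulas C /\ E \in subformulas C) -> P || Q ->
      D \in X :: subformulas B ++ subformulas C /\
      E \in X :: subformulas B ++ subformulas C.
    move=> HP HQ /orP[/HP|/HQ] [DF EF];
      by rewrite !inE !mem_cat DF EF ?orbT.
  split; rewrite in_cons mem_cat => /orP[/eqP XE|].
  - by apply: self; apply: XBC; apply: Or31.
  - exact: lift aB aC.
  - by apply: self; apply: XBC; apply: Or32.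
  - exact: lift oB oC.
  - by apply: self; apply: XBC; apply: Or33.
  - exact: lift iB iC.
elim: A => [p||A IA B IB|A IA B IB|A IA B IB] /=.
- by move=> B C; split; rewrite inE => /eqP.
- by move=> B C; split; rewrite inE => /eqP.
- by apply: closedU => // D E [] // [-> ->].
- by apply: closedU => // D E [] // [-> ->].
- by apply: closedU => // D E [] // [-> ->].
Qed.


Definition sequent := (set pform * set pform)%type.

Section Saturation.
Variable F : seq pform.
Hypothesis closedF : subformula_closed F.

(** Bounding sequents by F makes the search for maximal ones terminate. *)
Definition unprovable l (w : sequent) :=
  [/\ w.1 `<=` [set` F], w.2 `<=` [set` F] & ~ GSPL l w.1 w.2].

(** Extensions by single formulas suffice, because weakening carries
    underivability of a larger sequent over to the smaller ones. *)
Definition saturated l (w : sequent) := unprovable l w /\ forall A, A \in F ->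
  (~ GSPL l (A |` w.1) w.2 -> w.1 A) /\ (~ GSPL l w.1 (w.2 `|` [set A]) -> w.2 A).

(** This measure serves twice: its growth bounds the construction of a saturated
    extension, and it ranks the worlds of the countermodel. *)
Definition size_in (G : set pform) : nat := count (fun A => `[< G A >]) F.

Lemma size_in_le G : size_in G <= size F.
Proof. exact: count_size. Qed.

Lemma size_in_lt G H A : G `<=` H -> A \in F -> H A -> ~ G A ->
  size_in G < size_in H.
Proof.
move=> GH AF HA GA; rewrite /size_in.
have sub s : count (fun B => `[< G B >]) s <= count (fun B => `[< H B >]) s.
  by apply: sub_count => B /asboolP/GH ?; apply/asboolP.
elim: F AF => //= B s IH; rewrite inE => /predU1P[<-|/IH lt].
  by rewrite (asboolT HA) (asboolF GA) add0n add1n ltnS.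
rewrite -addnS; apply: leq_add => //.
by case: asboolP => // /GH HB; rewrite asboolT.
Qed.

(** While some one-formula extension stays underivable, adding it decreases the
    number of formulas of F missing from the two sides. *)
Lemma saturation l (w : sequent) : unprovable l w -> exists w' : sequent,
  [/\ w.1 `<=` w'.1, w.2 `<=` w'.2 & saturated l w'].
Proof.
have [n] := ubnP ((size F - size_in w.1) + (size F - size_in w.2)).
elim: n w => // n IH w ltn unw.
have [G_F D_F npw] := unw.
have subF (X : set pform) A : A \in F -> X `<=` [set` F] ->
    (A |` X `<=` [set` F]) by move=> AF XF B [->|/XF].
have [satw|] := pselect (saturated l w); first by exists w; split.
move=> nsat.
have [A [AF ext]] : exists A, A \in F /\
    (~ w.1 A /\ ~ GSPL l (A |` w.1) w.2 \/
     ~ w.2 A /\ ~ GSPL l w.1 (w.2 `|` [set A])).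
  apply: contrapT => noA; apply: nsat; split=> // A AF.
  by split=> np; apply: contrapT => nA; apply: noA; exists A; split; auto.
have dec (X : set pform) : ~ X A -> size F - size_in (A |` X) < size F - size_in X.
  move=> XA; have lt : size_in X < size_in (A |` X).
    by apply: (size_in_lt (A := A)) => //; left.
  by apply: ltn_sub2l => //; apply: (leq_trans lt); apply: size_in_le.
case: ext => -[nA np].
  have [||w' [GG DD sw']] := IH (A |` w.1, w.2).
  - by rewrite -ltnS (leq_trans _ ltn) // ltnS ltn_add2r dec.
  - by split=> //=; apply: subF.
  - by exists w'; split=> // B wB; apply: GG; right.
have [||w' [GG DD sw']] := IH (w.1, w.2 `|` [set A]).
- by rewrite -ltnS (leq_trans _ ltn) // ltnS ltn_add2l /= setUC dec.
- by split=> //=; rewrite setUC; apply: subF.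
- by exists w'; split=> // B wB; apply: DD; left.
Qed.

Lemma unprovable_sub l (w : sequent) Gam Del : unprovable l w ->
  Gam `<=` w.1 -> Del `<=` w.2 -> ~ GSPL l Gam Del.
Proof.
case=> GF DF np GG DD prov; apply: np; apply: (GSPL_weaken prov) => //.
  by apply: (sub_finite_set GF); apply/finite_seqP; exists F.
by apply: (sub_finite_set DF); apply/finite_seqP; exists F.
Qed.

Lemma unprovable_disjoint l w A : unprovable l w -> w.1 A -> w.2 A -> False.
Proof.
move=> unw GA DA; apply: (unprovable_sub unw (Gam := [set A]) (Del := [set A])).
- by move=> _ ->.
- by move=> _ ->.
- by case: l {unw}; [|apply: G_lift]; apply: GSPL_id.
Qed.

Lemma saturated_andl l w A B : saturated l w -> w.1 (PAnd A B) ->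
  w.1 A /\ w.1 B.
Proof.
case=> [[GF DF np] sat] ABG; have [/(_ (GF _ ABG))[AF BF] _ _] := closedF A B.
have np2 : ~ GSPL l (A |` (B |` w.1)) w.2.
  by move=> /G_andl; rewrite setUidr // => _ ->.
split; [apply: (sat A AF).1 | apply: (sat B BF).1] => prov; apply: np2.
  by rewrite setUCA; apply: G_wkl.
exact: G_wkl.
Qed.

Lemma saturated_andr l w A B : saturated l w -> w.2 (PAnd A B) ->
  w.2 A \/ w.2 B.
Proof.
case=> [[GF DF np] sat] ABD; have [/(_ (DF _ ABD))[AF BF] _ _] := closedF A B.
have [provA|/(sat A AF).2] := pselect (GSPL l w.1 (w.2 `|` [set A])); last by left.
right; apply: (sat B BF).2 => /(G_andr provA).
by rewrite setUidl // => _ ->.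
Qed.

Lemma saturated_orl l w A B : saturated l w -> w.1 (POr A B) ->
  w.1 A \/ w.1 B.
Proof.
case=> [[GF DF np] sat] ABG; have [_ /(_ (GF _ ABG))[AF BF] _] := closedF A B.
have [provA|/(sat A AF).1] := pselect (GSPL l (A |` w.1) w.2); last by left.
right; apply: (sat B BF).1 => /(G_orl provA).
by rewrite setUidr // => _ ->.
Qed.

Lemma saturated_orr l w A B : saturated l w -> w.2 (POr A B) ->
  w.2 A /\ w.2 B.
Proof.
case=> [[GF DF np] sat] ABD; have [_ /(_ (DF _ ABD))[AF BF] _] := closedF A B.
have np2 : ~ GSPL l w.1 (w.2 `|` [set A] `|` [set B]).
  by move=> /G_orr; rewrite setUidl // => _ ->.
split; [apply: (sat A AF).2 | apply: (sat B BF).2] => prov; apply: np2.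
  exact: G_wkr.
by rewrite setUAC; apply: G_wkr.
Qed.

(** Only level 2 has a left rule for implication; at level 1 implications of the
    antecedent constrain the successors only. *)
Lemma saturated_impl w A B : saturated L2 w -> w.1 (PImp A B) ->
  w.1 B \/ w.2 A.
Proof.
case=> [[GF DF np] sat] ABG; have [_ _ /(_ (GF _ ABG))[AF BF]] := closedF A B.
have [provA|/(sat A AF).2] := pselect (GSPL L2 w.1 (w.2 `|` [set A])); last by right.
left; apply: (sat B BF).1 => /(G_impl provA).
by rewrite setUidr // => _ ->.
Qed.

(** Strict growth of the antecedent makes the relation conversely well-founded, and
    growth alone makes it transitive: an implication decomposed at one step is
    still present, and so decomposed again, at every later one. *)
Definition accessible (w w' : sequent) :=
  [/\ saturated L1 w', w.1 `<=` w'.1,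
      exists2 A, A \in F & w'.1 A /\ ~ w.1 A &
      forall C D, w.1 (PImp C D) -> w'.1 D \/ w'.2 C].

Lemma accessible_trans w1 w2 w3 :
  accessible w1 w2 -> accessible w2 w3 -> accessible w1 w3.
Proof.
move=> [_ s12 [A AF [A2 A1]] _] [sat3 s23 _ step]; split=> //.
- exact: subset_trans s23.
- by exists A => //; split=> //; apply: s23.
- by move=> C D /s12/step.
Qed.

(** Right implication is applied with the whole antecedent as context and all its
    implications decomposed; some premise must be underivable, and a saturated
    extension of it is the required successor.  Its antecedent contains A -> B,
    which cannot be in that of w because identity sequents are derivable; hence
    the strict growth. *)
Lemma refute_implication w A B : unprovable L1 w -> w.2 (PImp A B) ->
  exists w', [/\ accessible w w', w'.1 A & w'.2 B].
Proof.
move=> unw ABD; have [GF DF _] := unw.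
have [_ _ /(_ (DF _ ABD))[AF BF]] := closedF A B.
(* The rule indexes implications by ordinals: list those of w, with PBot as the
   default component of formulas that are not implications. *)
pose left_of X := if X is PImp C _ then C else PBot.
pose right_of X := if X is PImp _ D then D else PBot.
pose imps := [seq X <- F | `[< w.1 X >] & (X == PImp (left_of X) (right_of X))].
pose k := size imps; pose I (j : 'I_k) := nth PBot imps j.
have Iw j : w.1 (PImp (left_of (I j)) (right_of (I j))).
  have : I j \in imps by apply: mem_nth.
  by rewrite mem_filter => /andP[/andP[/asboolP wI /eqP <-] _].
have wI C D : w.1 (PImp C D) -> exists2 j, left_of (I j) = C & right_of (I j) = D.
  move=> wCD; have CDi : PImp C D \in imps.
    by rewrite mem_filter /= eqxx asboolT // (GF _ wCD).
  have lt : index (PImp C D) imps < k by rewrite index_mem.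
  by exists (Ordinal lt); rewrite /I /= nth_index.
pose C j := left_of (I j); pose D j := right_of (I j).
pose Gam (i : 'I_(2 ^ k)) :=
  [set D j | j in [set j : 'I_k | bit j i]] `|` w.1 `|` [set PImp A B] `|` [set A].
pose Del (i : 'I_(2 ^ k)) := B |` [set C j | j in [set j : 'I_k | ~~ bit j i]].
have [i npi] : exists i, ~ GSPL L1 (Gam i) (Del i).
  apply: contrapT => /forallNP all_prov.
  have /G_impr : forall i, GSPL L1 (Gam i) (Del i).
    by move=> i; apply: contrapT; apply: all_prov.
  rewrite setUidl => [prov|_ [j _ <-]]; last exact: Iw.
  by apply: (unprovable_sub unw _ _ prov) => // _ ->.
have CDF j : C j \in F /\ D j \in F.
  by have [_ _] := closedF (C j) (D j); apply; apply: GF (Iw j).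
have [|w' [GG DD sw']] := @saturation L1 (Gam i, Del i).
  split=> //= X; last by case=> [->|[j _ <-]] //; apply: (CDF j).1.
  by case=> [[[[j _ <-]|/GF]|->]|->] //; [apply: (CDF j).2 | apply: DF].
exists w'; split; last by apply: DD; left.
  split=> //.
  - by move=> X wX; apply: GG; left; left; right.
  - exists (PImp A B); first exact: DF.
    split; first by apply: GG; left; right.
    by move=> /(unprovable_disjoint unw); apply.
  - move=> _ _ /wI[j <- <-]; case bji: (bit j i).
      by left; apply: GG; do 3 left; exists j.
    by right; apply: DD; right; exists j; rewrite //= bji.
by apply: GG; right.
Qed.

End Saturation.

(** * The tail model *)

Section TailModel.
Variables (F : seq pform) (root : sequent).
Hypothesis closedF : subformula_closed F.
Hypothesis sat_root : saturated F L2 root.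

(** [inr n] is the n-th copy of the root, counted downwards; [inr 0] plays the
    part of the root itself. *)
Definition world := (sequent + nat)%type.

Definition label (x : world) : sequent := if x is inl w then w else root.

Definition tail_rel (x y : world) : Prop :=
  match x, y with
  | _, inl w => accessible F (label x) w
  | inr m, inr n => n < m
  | inl _, inr _ => False
  end.

Definition tail_rank (x : world) : nat :=
  match x with
  | inl w => size F - size_in F w.1
  | inr n => (size F + n).+1
  end.

Lemma tail_rel_trans x y z : tail_rel x y -> tail_rel y z -> tail_rel x z.
Proof.
case: x y z => [w|m] [w'|n] [w''|p] //=; try exact: accessible_trans.
by move=> nm pn; apply: ltn_trans nm.
Qed.

Lemma tail_rel_rank x y : tail_rel x y -> tail_rank y < tail_rank x.
Proof.
case: x y => [w|m] [w'|n] //=.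
- case=> _ sub [A AF [A' nA]] _.
  have lt := size_in_lt sub AF A' nA.
  by apply: ltn_sub2l => //; apply: (leq_trans lt); apply: size_in_le.
- by move=> _; rewrite ltnS (leq_trans (leq_subr _ _)) // leq_addr.
- by rewrite ltnS ltn_add2l.
Qed.

Definition tail_val (p : nat) (x : world) : Prop := (label x).1 (PVar p).

Definition proper (x : world) : Prop :=
  if x is inl w then saturated F L1 w else True.

Lemma tail_rel_mono x y : tail_rel x y -> (label x).1 `<=` (label y).1.
Proof. by case: x y => [w|m] [w'|n] /=; by [case | move=> _]. Qed.

Lemma proper_level x : proper x -> exists l, saturated F l (label x).
Proof. by case: x => [w|n] /= satx; [exists L1 | exists L2]. Qed.

Lemma proper_unprovable x : proper x -> unprovable F L1 (label x).
Proof.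
case: x => [w []|n _] //=; have [[GF DF np] _] := sat_root.
by split=> // /G_lift.
Qed.

Lemma tail_rel_proper x y : tail_rel x y -> proper y.
Proof. by case: x y => [w|m] [w'|n] /=; by [case | move=> _]. Qed.

(** Between two copies of the root this is saturation of the root under left
    implication, which is why the root has to be saturated at level 2. *)
Lemma tail_rel_step x y C D : tail_rel x y -> (label x).1 (PImp C D) ->
  (label y).1 D \/ (label y).2 C.
Proof.
case: x y => [w|m] [w'|n] //=; try by case=> _ _ _; apply.
by move=> _; apply: (saturated_impl closedF sat_root).
Qed.

(** Persistence is built into the frame through the growth of antecedents, so the
    boxed conjunct in the translation of a variable is automatic. *)
Lemma tail_truth A x : proper x ->
  ((label x).1 A -> sat tail_rel tail_val x (visser A)) /\
  ((label x).2 A -> ~ sat tail_rel tail_val x (visser A)).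
Proof.
elim: A x => [p||A IA B IB|A IA B IB|A IA B IB] x px /=.
- split=> [Gp|Dp [Gp _]].
    by split=> // y /tail_rel_mono; apply.
  exact: (unprovable_disjoint (proper_unprovable px) Gp).
- split=> [Gbot|_ []].
  by apply: (unprovable_sub (proper_unprovable px) _ _ (G_bot L1)) => // _ ->.
- have [l satx] := proper_level px; have [tA fA] := IA x px; have [tB fB] := IB x px.
  split=> [/(saturated_andl closedF satx)[]|/(saturated_andr closedF satx)]; tauto.
- have [l satx] := proper_level px; have [tA fA] := IA x px; have [tB fB] := IB x px.
  split=> [/(saturated_orl closedF satx)|/(saturated_orr closedF satx)[]]; tauto.
- split=> [GAB y xy Ay|DAB box].
    have py := tail_rel_proper xy.
    have [/(IB y py).1//|/(IA y py).2 []//] := tail_rel_step xy GAB.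
  have [w' [acc A' B']] := refute_implication closedF (proper_unprovable px) DAB.
  have xw : tail_rel x (inl w') by case: (x) acc.
  have pw := tail_rel_proper xw.
  exact: (IB _ pw).2 B' (box _ xw ((IA _ pw).1 A')).
Qed.

End TailModel.

Theorem corollary5p8 (A : pform) : SPL A <-> logicS (visser A).
Proof.
split=> [provA|SA].
  have : level_logic L2 (visser_seq [::] [:: A]).
    by apply: (GSPL_sound provA) => // _ ->; rewrite /= mem_head.
  move=> H; apply: (theory_mp1 S_theory H) => v b.
  by move/eval_visser_seq => []// B; rewrite inE => /eqP->.
apply: contrapT => npA.
have closedF := @subformulas_closed A.
have [|root [_ DA satr]] := @saturation (subformulas A) L2 (set0, [set A]).
  by split=> //= _ ->; apply: subformulas_refl.
have [N /(_ N (leqnn N)) satA] := S_eventually (tail := inr) (tail_val root)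
  (@tail_rel_trans (subformulas A) root) (@tail_rel_rank _ root)
  (fun m n => id) SA.
have [_ falseA] := tail_truth closedF satr A (x := inr N) I.
exact: falseA (DA _ erefl) satA.
Qed.
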